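(* Let $\sigma\in S_n$ be a permutation with exactly $k$ cycles (including $1$-cycles). Then $$|\chi(\sigma)|\le 2^{k-1}\,k!$$ for all irreducible (complex) characters $\chi$ of $S_n$.
   Context: $S_n$ is the symmetric group on $\{1,\dots,n\}$. *)

(* Defs.v *)
From mathcomp Require Import all_boot all_order all_algebra all_fingroup.
From mathcomp Require Import all_solvable all_field all_character.

Set Implicit Arguments.
Unset Strict Implicit.
Unset Printing Implicit Defensive.

(* Main.v *)
Require Import Defs.
From mathcomp Require Import all_boot all_order all_algebra all_fingroup.
From mathcomp Require Import all_solvable all_field all_character.
From mathcomp Require Import zify.

Set Implicit Arguments.
Unset Strict Implicit.
Unset Printing Implicit Defensive.

Import Order.TTheory GRing.Theory Num.Theory.
Local Open Scope ring_scope.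

(** The bound holds without the factor [2 ^ (k - 1)].  Let [vdm_coef u] be the
    coefficient of x^u in the Vandermonde determinant and, for an integer vector
    [m], let [frob m] map a permutation to the sum of [vdm_coef (m - content w)]
    over the words w that it fixes: this is the coefficient of x^m in Vandermonde
    times power sums (Frobenius' formula).  It is an integer combination of the
    permutation characters on words of given content.  For strictly increasing
    nonnegative [m] with sum n + n(n-1)/2 it has norm 1: Burnside counting turns
    the norm into a signed count of nonnegative matrices, and Pieri's
    sign-reversing involution removes their rows one at a time.  Hence [frob m]
    is irreducible up to sign.  A given irreducible character is reached from the
    lexicographically largest content whose word character contains it.

    Peeling off the longest cycle, of length a >= size / k, writes the value of
    [frob m] as a sum over the entries of [m] that can be lowered by a while
    staying distinct and nonnegative.  Lowering all of them at once still leaves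
    distinct entries, so there are at most size / a <= k of them; induction on
    the number of cycles gives k!. *)

(** * Alternating functions and hook removal *)

(** Once the entries are sorted, the one at position i is at least i. *)
Lemma sum_uniq_ge (s : seq nat) :
  uniq s -> (\sum_(i < size s) i <= \sum_(x <- s) x)%N.
Proof.
move=> us; have st : sorted ltn (sort leq s).
  by rewrite ltn_sorted_uniq_leq sort_uniq us sort_sorted //; exact: leq_total.
rewrite -(perm_big _ (permEl (perm_sort leq s))) (big_nth 0%N) size_sort.
rewrite big_mkord; apply: leq_sum => i _.
have : (i < size (sort leq s))%N by rewrite size_sort.
elim: (nat_of_ord i) => // j IH lt; apply: leq_ltn_trans (IH (ltnW lt)) _.
exact: (sortedP 0%N st).
Qed.

Lemma sum_inj_ge N (u : 'I_N -> int) : (forall i, 0 <= u i) -> injective u ->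
  \sum_(i < N) (i : nat)%:Z <= \sum_i u i.
Proof.
move=> u0 ui.
have us : uniq [seq `|u i|%N | i <- enum 'I_N].
  rewrite map_inj_in_uniq ?enum_uniq // => i j _ _ e; apply: ui.
  by rewrite -[u i]gez0_abs // -[u j]gez0_abs // e.
have := sum_uniq_ge us; rewrite size_map size_enum_ord big_map big_enum /=.
rewrite -lez_nat !(big_morph Posz PoszD (erefl _)) => /le_trans; apply.
by rewrite ler_sum // => i _; rewrite gez0_abs.
Qed.

Section Alternating.
Variables (R : numDomainType) (N : nat).
Local Notation V := {ffun 'I_N -> int}.
Implicit Types (u m : V) (s p : 'S_N) (F G : V -> R).

Definition permv s u : V := [ffun i => u (s i)].
Definition permvec p : V := [ffun i => (p i : nat)%:Z].
Definition alternating F := forall s u, F (permv s u) = (-1) ^+ s * F u.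

(* The coefficient of x^u in the Vandermonde determinant det (x_i^j). *)
Definition vdm_coef u : R := \sum_(p : 'S_N) (-1) ^+ p * (u == permvec p)%:R.

Lemma permvK s : cancel (permv s) (permv s^-1).
Proof. by move=> u; apply/ffunP=> i; rewrite !ffunE permKV. Qed.

Lemma permvec_inj : injective permvec.
Proof.
move=> p q /ffunP e; apply/permP=> i; have := e i; rewrite !ffunE => -[].
exact: ord_inj.
Qed.

Lemma permvecM s p : permvec (s * p)%g = permv s (permvec p).
Proof. by apply/ffunP=> i; rewrite !ffunE permM. Qed.

Lemma alternating_vdm : alternating vdm_coef.
Proof.
move=> s u; rewrite /vdm_coef (reindex_inj (mulgI s)) mulr_sumr.
apply: eq_bigr => p _; rewrite odd_permM signr_addb permvecM mulrA.
by rewrite (inj_eq (can_inj (permvK s))).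
Qed.

Lemma vdm_permvec p : vdm_coef (permvec p) = (-1) ^+ p.
Proof.
rewrite /vdm_coef (bigD1 p) //= eqxx mulr1 big1 ?addr0 // => q /negPf qp.
by rewrite (inj_eq permvec_inj) eq_sym qp mulr0.
Qed.

Lemma vdm_neq0 u : vdm_coef u != 0 -> exists p, u = permvec p.
Proof.
case: (pickP (fun p => u == permvec p)) => [p /eqP -> | e]; first by exists p.
by rewrite /vdm_coef big1 ?eqxx // => p _; rewrite e mulr0.
Qed.

Lemma norm_vdm u : `|vdm_coef u| <= 1.
Proof.
have [->|/vdm_neq0[p ->]] := eqVneq (vdm_coef u) 0; first by rewrite normr0.
by rewrite vdm_permvec normr_sign.
Qed.

(** Transposing two equal entries fixes [u] but negates [F u]. *)
Lemma alternating_eq0 F u i j : alternating F -> i != j -> u i = u j -> F u = 0.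
Proof.
move=> aF ij uij; apply/eqP; rewrite -eqNr; apply/eqP.
have := aF (tperm i j) u; rewrite odd_tperm ij mulN1r => <-.
by congr F; apply/ffunP=> x; rewrite ffunE; case: tpermP => // ->.
Qed.

Section Walk.
Variables (X : finType) (P : nat -> pred X) (d : nat -> X -> V).

(** Unfolding subtracts the step of highest index first. Cycles and parts are indexed by increasing
    size, so each induction starts with the longest cycle or the row of the largest part. *)
Fixpoint walk F k m : R :=
  if k is k'.+1 then \sum_(x | P k' x) walk F k' (m - d k' x) else F m.

Lemma sum_walk F k m :
  \sum_(phi : {ffun 'I_k -> X} | [forall i : 'I_k, P i (phi i)])
      F (m - \sum_(i < k) d i (phi i)) = walk F k m.
Proof.
elim: k m => [|k IH] m /=.
  rewrite (eq_bigr (fun _ => F m)) => [|phi _]; last by rewrite big_ord0 subr0.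
  rewrite (eq_bigl predT) => [|phi]; last by apply/forallP; case.
  by rewrite big_const card_ffun card_ord expn0 /= addr0.
have wl (i : 'I_k) : widen_ord (leqnSn k) i = lift ord_max i.
  by apply: val_inj; rewrite /= /bump leqNgt ltn_ord.
pose ext (y : X * {ffun 'I_k -> X}) : {ffun 'I_k.+1 -> X} :=
  [ffun i => if unlift ord_max i is Some j then y.2 j else y.1].
have ext_max y : ext y ord_max = y.1 by rewrite ffunE unlift_none.
have ext_lift y i : ext y (lift ord_max i) = y.2 i by rewrite ffunE liftK.
have ext_bij : bijective ext.
  exists (fun phi : {ffun 'I_k.+1 -> X} =>
      (phi ord_max, [ffun i : 'I_k => phi (lift ord_max i)])).
    move=> [x phi]; rewrite ext_max; congr (_, _); apply/ffunP=> i.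
    by rewrite ffunE ext_lift.
  move=> phi; apply/ffunP=> i; rewrite ffunE.
  by case: unliftP => [j|] ->; rewrite ?ffunE.
rewrite (reindex ext) /=; last exact: onW_bij.
rewrite (eq_bigl (fun y : X * {ffun 'I_k -> X} =>
  P k y.1 && [forall i : 'I_k, P i (y.2 i)])); last first.
  move=> y; apply/forallP/andP=> [h|[h1 /forallP h2] i].
    split; first by have := h ord_max; rewrite ext_max.
    by apply/forallP=> i; have := h (lift ord_max i); rewrite ext_lift -wl.
  case: (unliftP ord_max i) => [j ->|->]; last by rewrite ext_max.
  by rewrite ext_lift -wl; exact: h2.
rewrite -(pair_big (P k)
  (fun phi : {ffun 'I_k -> X} => [forall i : 'I_k, P i (phi i)])
  (fun x phi => F (m - \sum_(i < k.+1) d i (ext (x, phi) i)))) /=.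
apply: eq_bigr => x _; rewrite -IH; apply: eq_bigr => phi _.
rewrite big_ord_recr /= ext_max /= [_ + d k x]addrC opprD addrA.
by congr (F (_ - _)); apply: eq_bigr => i _; rewrite wl ext_lift.
Qed.

(** When permuting coordinates only reshuffles the allowed steps, reindexing by [rho s] passes the
    sign on from [F]. *)
Lemma alternating_walk F k (rho : 'S_N -> X -> X) :
    (forall s, injective (rho s)) ->
    (forall i s x, P i (rho s x) = P i x) ->
    (forall i s x, d i (rho s x) = permv s (d i x)) ->
  alternating F -> alternating (walk F k).
Proof.
move=> rI Pr dr aF; elim: k => //= k IH s u.
rewrite (reindex_inj (rI s)) mulr_sumr.
apply: eq_big => [x|x _]; first exact: Pr.
by rewrite dr -IH; congr walk; apply/ffunP=> i; rewrite !ffunE.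
Qed.

End Walk.
End Alternating.

Section HookWalk.
Variables (R : numDomainType) (N : nat).
Local Notation V := {ffun 'I_N -> int}.

Definition spike (a : int) (j : 'I_N) : V :=
  [ffun i => if i == j then a else 0].

Lemma sum_spike a j : \sum_i spike a j i = a.
Proof.
by under eq_bigr do rewrite ffunE; rewrite -big_mkcond big_pred1_eq.
Qed.

Variables (s : nat -> nat).

(** The coefficient of x^m in Vandermonde times the power sums of degrees [s 0], ..., [s (k - 1)]:
    choosing [j] at step i picks the term x_j^(s i). *)
Definition hook_walk (k : nat) (m : V) : R :=
  walk (fun _ => predT) (fun i j => spike (s i)%:Z j) (@vdm_coef R N) k m.

Lemma alternating_hook_walk k : alternating (hook_walk k).
Proof.
apply: (@alternating_walk _ _ _ _ _ _ _
  (fun p : 'S_N => (p^-1)%g : 'S_N)) => //.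
- by move=> p; exact: perm_inj.
- move=> i p j; apply/ffunP=> x; rewrite !ffunE.
  by rewrite -[in LHS](inj_eq (@perm_inj _ p)) permKV.
- exact: alternating_vdm.
Qed.

(** Nonnegativity and the sum are inherited from the exponent vectors of the Vandermonde
    determinant; distinctness comes from alternation. *)
Lemma hook_walk_neq0 k m : hook_walk k m != 0 ->
  [/\ forall i, 0 <= m i, injective m &
      \sum_i m i = \sum_(i < N) (i : nat)%:Z + \sum_(i < k) (s i)%:Z].
Proof.
move=> nz; suff [m0 ms] : (forall i, 0 <= m i) /\
   \sum_i m i = \sum_(i < N) (i : nat)%:Z + \sum_(i < k) (s i)%:Z.
  split=> // i j e; apply/eqP/negPn/negP=> ij; case/eqP: nz.
  exact: alternating_eq0 (alternating_hook_walk k) ij e.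
elim: k m nz => [|k IH] m /= nz.
  have [p ->] := vdm_neq0 nz; split=> [i|]; first by rewrite ffunE.
  rewrite big_ord0 addr0 [RHS](reindex_inj (@perm_inj _ p)) /=.
  by apply: eq_bigr => i _; rewrite ffunE.
have [j /IH[m0 ms]] : exists j, hook_walk k (m - spike (s k) j) != 0.
  apply/existsP; apply: contraNT nz; rewrite negb_exists => /forallP h.
  rewrite /hook_walk /= big1 // => j _; apply/eqP.
  by have := h j; rewrite negbK.
split=> [i|].
  have := m0 i; rewrite !ffunE; case: eqP => _; last by rewrite subr0.
  by move=> h; apply: le_trans h _; rewrite gerBl.
rewrite big_ord_recr /= addrA -ms -[X in _ + X](sum_spike _ j) -big_split /=.
by apply: eq_bigr => i _; rewrite !ffunE subrK.
Qed.

(* If J is the set of beads of m that can be moved down by a = s k, moving all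
   of them at once still leaves distinct positions, so a #|J| <= size. *)
Lemma norm_hook_walk k m :
    (forall i j, (i <= j)%N -> (j < k)%N -> (s i <= s j)%N) ->
    (forall i, (i < k)%N -> (0 < s i)%N) ->
  `|hook_walk k m| <= k`!%:R.
Proof.
elim: k m => [|k IH] m smono spos; first exact: norm_vdm.
have [->|nz] := eqVneq (hook_walk k.+1 m) 0; first by rewrite normr0 ler0n.
have [m0 minj msum] := hook_walk_neq0 nz.
set a := s k in smono spos; have a0 : (0 < a)%N by exact: spos.
pose J := [set j | hook_walk k (m - spike a%:Z j) != 0].
have Jle : (#|J| <= k.+1)%N.
  pose u i := m i - (if i \in J then a%:Z else 0).
  have u0 i : 0 <= u i.
    rewrite /u; case: ifP => [|_]; last by rewrite subr0.
    rewrite inE => /hook_walk_neq0[/(_ i) + _ _].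
    by rewrite !ffunE eqxx.
  (* A moved bead cannot land on an unmoved one: that move alone would already repeat a position. *)
  have JnJ i j : i \in J -> j \notin J -> m i - a%:Z != m j.
    move=> iJ jJ; apply/eqP=> e; have ij : i != j by apply: contraNneq jJ => <-.
    move: iJ; rewrite inE => /hook_walk_neq0[_ /(_ i j) + _].
    rewrite !ffunE eqxx eq_sym (negPf ij) subr0 => /(_ e) eij.
    by rewrite eij eqxx in ij.
  have uinj : injective u.
    move=> i j; rewrite /u; case: ifPn => iJ; case: ifPn => jJ.
    - by move/addIr/minj.
    - by rewrite subr0 => /eqP; rewrite (negPf (JnJ _ _ iJ jJ)).
    - by rewrite subr0 => /esym/eqP; rewrite (negPf (JnJ _ _ jJ iJ)).
    - by rewrite !subr0 => /minj.
  (* Distinct positions have sum at least 0 + ... + (N - 1), so [a] times [#|J|] is at most the sum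
     of the k + 1 step lengths, each at most [a]. *)
  have := sum_inj_ge u0 uinj; rewrite sumrB msum -big_mkcond /= sumr_const.
  rewrite -addrA lerDl subr_ge0 -mulr_natr => le1.
  have : \sum_(i < k.+1) (s i)%:Z <= a%:Z * (k.+1)%:R.
    rewrite mulr_natr; have -> : a%:Z *+ k.+1 = \sum_(i < k.+1) a%:Z.
      by rewrite sumr_const card_ord.
    by apply: ler_sum => i _; rewrite lez_nat smono // -ltnS.
  by move/(le_trans le1); rewrite ler_pM2l ?ltz_nat // ler_nat.
rewrite /hook_walk /=; apply: le_trans (ler_norm_sum _ _ _) _.
rewrite (bigID (mem J)) /= [X in _ + X]big1 ?addr0; last first.
  by move=> i; rewrite inE negbK => /eqP e; rewrite [walk _ _ _ _ _]e normr0.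
apply: (@le_trans _ _ (\sum_(i in J) k`!%:R)).
  apply: ler_sum => i _; apply: IH => [x y xy yk|x xk]; last exact/spos/ltnW.
  exact/smono/ltnW.
by rewrite sumr_const -mulrnA ler_nat factS mulnC leq_mul2r Jle orbT.
Qed.

End HookWalk.

(** * Pieri's rule *)

Section Pieri.
Variables (R : numDomainType) (N B : nat).
Local Notation V := {ffun 'I_N -> int}.
Local Notation X := {ffun 'I_N -> 'I_B.+1}.

(** Capping entries at [B] makes the steps a finite type; a nonnegative vector of sum at most [B] is
    always of this form. *)
Definition vecz (v : X) : V := [ffun i => (v i : nat)%:Z].

Lemma vecz_inj : injective vecz.
Proof.
move=> v w /ffunP e; apply/ffunP=> i; have := e i; rewrite !ffunE => -[].
exact: ord_inj.
Qed.

Lemma vecz_surj (u : V) :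
  (forall i, 0 <= u i) -> (forall i, u i <= B%:Z) -> exists v, vecz v = u.
Proof.
move=> u0 uB; exists [ffun i => inord `|u i|%N]; apply/ffunP=> i.
by rewrite !ffunE inordK ?gez0_abs // ltnS -lez_nat gez0_abs.
Qed.

Variables (G : V -> R) (m sh : V) (a : int).
Hypothesis aG : alternating G.

(** From index k on, each bead, once lowered by [v], stays strictly above the old position of the
    bead before it: the horizontal strip condition. *)
Let rise k (v : X) := [forall i : 'I_N, forall j : 'I_N,
  (j == i.+1 :> nat) && (k <= i)%N ==> (m i < m j - vecz v j)].

(** The sign-reversing involution [rho] exchanges entries i and i + 1 of [m - v] while keeping [m].
    The new steps are nonnegative because the strip condition fails at i and [m i <= m j], and it
    fails again after the exchange. *)
Lemma bad_rise_sum (i j : 'I_N) : j = i.+1 :> nat -> m i <= m j -> a <= B%:Z ->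
  \sum_(v : X | (\sum_x vecz v x == a) && rise i.+1 v &&
      ~~ (m i < m j - vecz v j))
     G (m - vecz v) = 0.
Proof.
move=> ji mij aB; have ij : i != j by apply/eqP=> e; move: ji; rewrite e; lia.
pose bad (v : X) :=
  (\sum_x vecz v x == a) && rise i.+1 v && ~~ (m i < m j - vecz v j).
pose t := tperm i j.
pose rho (v : X) : X :=
  [ffun x => inord (absz (m x - (m (t x) - vecz v (t x)))%R)].
have tt x : t (t x) = x by rewrite /t tpermK.
have re (u : V) : \sum_x u (t x) = \sum_x u x.
  by rewrite [RHS](reindex_inj (@perm_inj _ t)).
have v0 (v : X) x : 0 <= vecz v x by rewrite ffunE.
have rhoE v : bad v -> m - vecz (rho v) = permv t (m - vecz v).
  case/andP=> /andP[/eqP vs _]; rewrite -leNgt => vb.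
  pose w : V := [ffun x => m x - (m (t x) - vecz v (t x))].
  have w0 x : 0 <= w x.
    rewrite [w x]ffunE /t; case: tpermP => [->|->|_ _]; last by have := v0 v x; lia.
      by lia.
    by have := v0 v i; lia.
  have ws : \sum_x w x = a.
    under eq_bigr => x _ do rewrite [w x]ffunE.
    rewrite sumrB sumrB.
    by rewrite !re vs subKr.
  (* Nonnegative entries of sum [a] are at most [a <= B], so [absz] and [inord] in [rho] lose
     nothing. *)
  have wB x : w x <= B%:Z.
    apply: le_trans aB; rewrite -ws (bigD1 x) //= lerDl; exact: sumr_ge0.
  have [v' v'E] := vecz_surj w0 wB.
  have -> : rho v = v'.
    by apply/ffunP=> x; rewrite ffunE; have := congr1 (fun u : V => u x) v'E;
       rewrite [in RHS]ffunE => <-; rewrite ffunE absz_nat inord_val.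
  by rewrite v'E; apply/ffunP=> x; rewrite !ffunE subKr.
have badr v : bad v -> bad (rho v).
  move=> bv; have e := rhoE v bv.
  have ex x : m x - vecz (rho v) x = m (t x) - vecz v (t x).
    by have := congr1 (fun u : V => u x) e; rewrite !ffunE.
  case/andP: bv => /andP[/eqP vs /forallP rv]; rewrite -leNgt => vb.
  apply/andP; split; first apply/andP; first split.
  - have : \sum_x (m x - vecz (rho v) x) = \sum_x (m x - vecz v x).
      by rewrite [RHS](reindex_inj (@perm_inj _ t)); exact: eq_bigr.
    by rewrite !sumrB vs => /addrI /oppr_inj ew; apply/eqP.
  (* [rise i.+1] reads [v] only at indices beyond [j], which the exchange leaves alone. *)
  - apply/forallP=> x; apply/forallP=> y; apply/implyP=> /andP[yx ix].
    rewrite ex /t tpermD; last 2 first.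
    + by apply/eqP=> ey; move: ix yx; rewrite -ey; lia.
    + by apply/eqP=> ey; move: ix yx; rewrite -ey; lia.
    by have /forallP/(_ y)/implyP := rv x; rewrite yx ix; exact.
  - by rewrite -leNgt ex /t tpermR; have := v0 v i; lia.
have rhoK v : bad v -> rho (rho v) = v.
  move=> bv; apply: vecz_inj; have e := rhoE _ (badr v bv).
  rewrite (rhoE v bv) in e.
  apply/ffunP=> x; have := congr1 (fun u : V => u x) e.
  by rewrite [permv t (permv t _) x]ffunE [permv t _ _]ffunE tt !ffunE; lia.
apply/eqP; rewrite -eqNr; apply/eqP; rewrite [RHS](reindex_onto rho rho) //=.
rewrite -sumrN; apply: eq_big => [v|v bv].
  apply/idP/andP => [bv|[br /eqP <-]]; last exact: badr.
  by split; [exact: badr | rewrite rhoK].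
by rewrite rhoE // aG odd_tperm ij mulN1r.
Qed.

(** Here [sh] is [m] with its largest part removed. After cancellation each surviving [m - v]
    dominates [sh] entrywise, while its sum is at most that of [sh]; hence it equals [sh]. *)
Lemma pieri :
    (forall u, G u != 0 -> forall i, 0 <= u i) ->
    (forall i, 0 <= m i) -> (forall i, m i <= B%:Z) ->
    (forall i j : 'I_N, (i < j)%N -> m i < m j) ->
    (forall i : 'I_N, i = 0%N :> nat -> sh i = 0) ->
    (forall i j : 'I_N, j = i.+1 :> nat -> sh j = m i + 1) ->
    a <= B%:Z -> \sum_i m i - \sum_i sh i <= a ->
  \sum_(v : X | \sum_i vecz v i == a) G (m - vecz v) =
    if \sum_i m i - \sum_i sh i == a then G sh else 0.
Proof.
move=> G0 m0 mB minc sh0 shS aB shle.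
pose S k := \sum_(v : X | (\sum_x vecz v x == a) && rise k v) G (m - vecz v).
(* Passing from k + 1 to k imposes the strip condition at one more index, and its violators cancel.
   At N the condition is vacuous; at 0 it is the full one. *)
have Sstep k : S k.+1 = S k.
  case: (ltnP k.+1 N) => kN.
    pose i := Ordinal (ltnW kN); pose j := Ordinal kN.
    rewrite /S (bigID (fun v => m i < m j - vecz v j)) /=.
    rewrite [X in _ + X](bad_rise_sum (i := i) (j := j)) ?addr0 //; last first.
      by apply/ltW/minc => /=.
    apply: eq_bigl => v; rewrite -andbA; congr (_ && _).
    apply/andP/forallP=> [[/forallP h hij] x|h].
      apply/forallP=> y; apply/implyP=> /andP[yx].
      rewrite leq_eqVlt => /orP[/eqP kx|kx].
        have -> : x = i by apply: val_inj.
        by have -> : y = j by apply: val_inj; rewrite /= (eqP yx) kx.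
      by have /forallP/(_ y)/implyP := h x; rewrite yx kx; exact.
    split; last first.
      by have /forallP/(_ j)/implyP := h i; rewrite /= eqxx leqnn; exact.
    apply/forallP=> x; apply/forallP=> y; apply/implyP=> /andP[yx kx].
    by have /forallP/(_ y)/implyP := h x; rewrite yx (ltnW kx); exact.
  apply: eq_bigl => v; congr (_ && _); rewrite /rise.
  apply: eq_forallb => x; apply: eq_forallb => y; have := ltn_ord y.
  by case: eqP => //= ->; do 2 case: leqP => //; lia.
have -> : \sum_(v : X | \sum_i vecz v i == a) G (m - vecz v) = S 0%N.
  transitivity (S N); last by elim: N => // k <-; rewrite Sstep.
  apply: eq_bigl => v; symmetry; case: eqP => //= _.
  apply/forallP=> x; apply/forallP=> y.
  by rewrite leqNgt ltn_ord andbF.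
have key (v : X) : \sum_x vecz v x = a -> rise 0 v -> G (m - vecz v) != 0 ->
    \sum_i m i - \sum_i sh i = a /\ m - vecz v = sh.
  move=> va /forallP rv /G0 nn.
  have ge x : sh x <= (m - vecz v) x.
    case ex: (nat_of_ord x) => [|y]; first by rewrite sh0.
    have yN : (y < N)%N by have := ltn_ord x; lia.
    rewrite (shS (Ordinal yN)) // !ffunE.
    have /forallP/(_ x)/implyP := rv (Ordinal yN).
    by rewrite /= ex eqxx => /(_ isT); rewrite !ffunE; lia.
  have sumE : \sum_x (m - vecz v) x = \sum_x m x - a.
    by rewrite -va -sumrB; apply: eq_bigr => x _; rewrite !ffunE.
  have le : \sum_x sh x <= \sum_x (m - vecz v) x by exact: ler_sum.
  have e : \sum_i m i - \sum_i sh i = a by lia.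
  split=> //; apply/ffunP=> x; apply/eqP; rewrite -subr_eq0.
  have : \sum_x ((m - vecz v) x - sh x) == 0.
    by rewrite sumrB sumE -e subKr subrr.
  rewrite psumr_eq0 => [/allP/(_ x (mem_index_enum _))//|y _].
  by rewrite subr_ge0.
case: eqP => e; last first.
  rewrite /S big1 // => v /andP[/eqP va rv]; apply/eqP/negPn/negP => nz.
  by have [] := key v va rv nz.
have shle_m x : 0 <= sh x <= m x.
  case ex: (nat_of_ord x) => [|y]; first by rewrite sh0 ?m0.
  have yN : (y < N)%N by have := ltn_ord x; lia.
  have lt : m (Ordinal yN) < m x by apply: minc; rewrite ex.
  by rewrite (shS (Ordinal yN)) // lezD1 lt addr_ge0.
have [|x|v vE] := @vecz_surj (m - sh).
- by move=> x; rewrite !ffunE subr_ge0; case/andP: (shle_m x).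
- rewrite !ffunE; case/andP: (shle_m x) => h _.
  by apply: le_trans (mB x); rewrite gerBl.
have mv : m - vecz v = sh by rewrite vE subKr.
rewrite /S (bigD1 v) /=; last first.
  apply/andP; split.
    rewrite -e -sumrB; apply/eqP; apply: eq_bigr => x _; rewrite vE.
    by rewrite !ffunE.
  apply/forallP=> x; apply/forallP=> y; apply/implyP=> /andP[/eqP yx _].
  by rewrite vE !ffunE subKr (shS x y yx) ltrDl.
rewrite mv big1 ?addr0 // => w /andP[/andP[/eqP wa rw] wv].
apply/eqP; apply: contraNT wv => /(key w wa rw)[_ h]; apply/eqP/vecz_inj.
by rewrite vE -h subKr.
Qed.

End Pieri.

(** * Row removal in nonnegative matrices *)

Section RowWalk.
Variables (R : numDomainType) (N B : nat) (r : nat -> int).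
Local Notation V := {ffun 'I_N -> int}.
Local Notation X := {ffun 'I_N -> 'I_B.+1}.

(** For [r i <= B], the coefficient of x^m in Vandermonde times the complete homogeneous polynomials
    of degrees [r 0], ..., [r (k - 1)]. *)
Definition row_walk (k : nat) (m : V) : R :=
  walk (fun i (v : X) => \sum_x vecz v x == r i) (fun _ => @vecz N B)
    (@vdm_coef R N) k m.

Lemma alternating_row_walk k : alternating (row_walk k).
Proof.
apply: (@alternating_walk _ _ _ _ _ _ _
  (fun p (v : X) => [ffun x => v (p x)])) => [p v w /ffunP e|i p v|i p v|].
- by apply/ffunP=> x; have := e (p^-1 x)%g; rewrite !ffunE permKV.
- congr (_ == _); rewrite [RHS](reindex_inj (@perm_inj _ p)).
  by apply: eq_bigr => x _; rewrite !ffunE.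
- by apply/ffunP=> x; rewrite !ffunE.
- exact: alternating_vdm.
Qed.

Lemma row_walk_ge0 k m : row_walk k m != 0 -> forall i, 0 <= m i.
Proof.
elim: k m => [|k IH] m /= nz.
  by have [p ->] := vdm_neq0 nz => i; rewrite ffunE.
have [v /IH m0] : exists v, row_walk k (m - @vecz N B v) != 0.
  apply/existsP; apply: contraNT nz; rewrite negb_exists => /forallP h.
  by rewrite /row_walk /= big1 // => v _; apply/eqP; have := h v; rewrite negbK.
by move=> i; apply: le_trans (m0 i) _; rewrite !ffunE gerBl.
Qed.

Variable lam : nat -> nat.
Hypothesis lam_mono : forall i j, (i <= j < N)%N -> (lam i <= lam j)%N.
Hypothesis lam_bound : forall i, (i < N)%N -> (i + lam i <= B)%N.

(* The beta-numbers of the partition left when the j largest parts of lam are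
   removed. *)
Definition beta j : V :=
  [ffun i : 'I_N => (i + (if (i < j)%N then 0 else lam (i - j)))%:Z].

Lemma sum_beta j : (j <= N)%N ->
  \sum_i beta j i = \sum_(i < N) (i : nat)%:Z + \sum_(i < N - j) (lam i)%:Z.
Proof.
move=> jN; under eq_bigr do rewrite ffunE PoszD; rewrite big_split /=.
congr (_ + _).
rewrite -(big_mkord predT (fun i => (if (i < j)%N then 0 else lam (i - j))%:Z)).
rewrite (big_cat_nat (n := j)) //= big_nat_cond big1 ?add0r; last first.
  by move=> i /andP[/andP[_ ->]].
rewrite -{1}[j]add0n big_addn big_mkord; apply: eq_bigr => i _.
by rewrite addnK ltnNge leq_addl.
Qed.

(** The largest part in [beta (N - k.+1)] is [lam k], so by [pieri] a row of at least that sum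
    either strips exactly this part or leaves nothing. *)
Lemma row_walk_peel k : (k < N)%N -> (lam k)%:Z <= r k -> r k <= B%:Z ->
  row_walk k.+1 (beta (N - k.+1)) =
    if (lam k)%:Z == r k then row_walk k (beta (N - k)) else 0.
Proof.
move=> kN lr rB; set j := (N - k.+1)%N; have -> : (N - k)%N = j.+1 by lia.
have e : \sum_i beta j i - \sum_i beta j.+1 i = (lam k)%:Z.
  rewrite !sum_beta; [|by rewrite /j; lia..].
  have -> : (N - j)%N = k.+1 by rewrite /j; lia.
  have -> : (N - j.+1)%N = k by rewrite /j; lia.
  by rewrite big_ord_recr /= opprD addrACA subrr add0r addrAC subrr add0r.
rewrite -e /row_walk /=; apply: pieri; rewrite ?e //.
- exact: alternating_row_walk.
- exact: row_walk_ge0.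
- by move=> i; rewrite ffunE.
- move=> i; rewrite ffunE lez_nat; case: ifP => ij.
    by have := lam_bound (ltn_ord i); lia.
  apply: leq_trans (lam_bound (ltn_ord i)); rewrite leq_add2l lam_mono //.
  by rewrite leq_subr ltn_ord.
- move=> i i' ii'; rewrite !ffunE ltz_nat; case: ifP => ij; case: ifP => ij'; try lia.
  suff: (lam (i - j) <= lam (i' - j))%N by lia.
  by apply: lam_mono; have := ltn_ord i'; lia.
- by move=> i i0; rewrite ffunE i0.
- move=> i i' ii'; rewrite !ffunE ii' ltnS subSS; case: ifP; lia.
Qed.

Lemma row_walk_eq1 k :
    (k <= N)%N -> (forall i, (i < k)%N -> r i = (lam i)%:Z) ->
  row_walk k (beta (N - k)) = 1.
Proof.
elim: k => [|k IH] kN rl.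
  rewrite subn0; have -> : beta N = permvec 1.
    by apply/ffunP=> i; rewrite !ffunE ltn_ord addn0 perm1.
  by rewrite [LHS]vdm_permvec odd_perm1.
rewrite row_walk_peel ?rl // ?eqxx ?IH // 1?ltnW // => [i ik|].
  by apply: rl; exact: ltnW.
by rewrite lez_nat; have := lam_bound kN; lia.
Qed.

(** The rows after i strip the parts they match; row i then exceeds the largest part left. *)
Lemma row_walk_eq0 k i : (i < k <= N)%N -> (lam i)%:Z < r i ->
    (forall j, (i <= j < k)%N -> r j <= B%:Z) ->
    (forall j, (i < j < k)%N -> r j = (lam j)%:Z) ->
  row_walk k (beta (N - k)) = 0.
Proof.
elim: k => // k IH ik lr rB rl; case: (eqVneq i k) => [ik'|ik'].
  rewrite ik' in ik lr rB; rewrite row_walk_peel ?(lt_eqF lr) //; first lia.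
    exact: ltW.
  by apply: rB; lia.
have rk : r k = (lam k)%:Z by apply: rl; lia.
have kN : (k < N)%N by lia.
rewrite row_walk_peel ?rk ?eqxx //; last by rewrite -rk; apply: rB; lia.
by apply: IH => // [|j hj|j hj]; [lia | apply: rB; lia | apply: rl; lia].
Qed.

End RowWalk.

(** * Words and permutation characters *)

Section Words.
Variables (n B : nat) (X : finType).
Local Notation W := {ffun 'I_n -> X}.
Implicit Types (w : W) (s : 'S_n).

Definition rename s w : W := [ffun i => w (s i)].

(** Bounding multiplicities by [B] makes contents a finite type; [inord] is exact since [n <= B]. *)
Definition content w : {ffun X -> 'I_B.+1} :=
  [ffun x => inord #|[set i | w i == x]|].

Hypothesis nB : (n <= B)%N.

Lemma contentE w x : content w x = #|[set i | w i == x]| :> nat.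
Proof.
rewrite ffunE inordK // ltnS; apply: leq_trans nB.
by rewrite -[leqRHS](card_ord n) max_card.
Qed.

Lemma renameM s t w : rename (s * t) w = rename s (rename t w).
Proof. by apply/ffunP=> i; rewrite !ffunE permM. Qed.

Lemma content_rename s w : content (rename s w) = content w.
Proof.
apply/ffunP=> x; apply: val_inj; rewrite /= !contentE.
rewrite -(card_imset _ (@perm_inj _ s)); apply: eq_card => i.
apply/imsetP/idP => [[j jw ->]|iw]; first by move: jw; rewrite !inE ffunE.
by exists (s^-1 i)%g; move: iw; rewrite ?inE ?ffunE permKV.
Qed.

Lemma sum_content w : (\sum_x content w x = n)%N.
Proof.
rewrite -[RHS](card_ord n) -sum1_card (partition_big w predT) //=.
apply: eq_bigr => x _; rewrite contentE -sum1_card.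
by apply: eq_bigl => i; rewrite inE.
Qed.

Lemma count_word w x : count_mem x [tuple w i | i < n] = #|[set i | w i == x]|.
Proof. by rewrite /= count_map cardsE cardE size_filter -enumT. Qed.

Lemma content_inj_rename w w' :
  content w = content w' -> exists s, w = rename s w'.
Proof.
move=> e; have : perm_eq [tuple w i | i < n] [tuple w' i | i < n].
  apply/allP=> x _ /=; apply/eqP; rewrite !count_word -!contentE.
  by rewrite e.
case/tuple_permP=> s es; exists s; apply/ffunP=> i; rewrite ffunE.
have := congr1 (fun t => nth (w i) t i) es.
by rewrite -!tnth_nth !tnth_mktuple.
Qed.

Lemma content_surj (A : {ffun X -> 'I_B.+1}) :
  (\sum_x A x)%N = n -> exists w, content w = A.
Proof.
move=> An; pose l := flatten [seq nseq (A x) x | x <- enum X].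
have sl : size l == n.
  rewrite size_flatten /shape -map_comp sumnE big_map big_enum /= -An.
  by apply/eqP/eq_bigr=> x _; rewrite /= size_nseq.
exists [ffun i => tnth (Tuple sl) i]; apply/ffunP=> x; apply: val_inj.
rewrite /= contentE -count_word (_ : [tuple _ | _ < _] = Tuple sl); last first.
  by apply: eq_from_tnth => i; rewrite tnth_mktuple ffunE.
rewrite count_flatten -map_comp sumnE big_map big_enum /= (bigD1 x) //=.
rewrite count_nseq /= eqxx mul1n big1 ?addn0 // => y yx.
by rewrite count_nseq /= (negPf yx).
Qed.

(** The permutations taking [w0] to a word [w] of the same content form a coset of the stabilizer of
    [w], and these cosets partition the group. *)
Lemma sum_stab_class w0 :
  (\sum_(w | content w == content w0) #|[set s | rename s w == w]| = n`!)%N.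
Proof.
rewrite -card_Sn -sum1_card (partition_big (fun s => rename s w0)
   (fun w => content w == content w0)) /=; last first.
  by move=> s _; rewrite content_rename.
apply: eq_bigr => w /eqP/content_inj_rename[s0 ->].
rewrite (eq_bigl (mem [set s | rename s w0 == rename s0 w0])); last first.
  by move=> s; rewrite !inE.
rewrite sum1_card -[LHS](card_imset _ (@mulIg _ s0)); apply: eq_card => s.
apply/imsetP/idP => [[t + ->]|]; first by rewrite !inE renameM.
rewrite inE => e; exists (s * s0^-1)%g; last by rewrite mulgKV.
by rewrite inE -renameM mulgKV.
Qed.

(* Words with a given content form one orbit, so this is Burnside's count of the
   orbits of words, weighted by a function of the content. *)
Lemma sum_fixed_words (R : pzSemiRingType) (Phi : {ffun X -> 'I_B.+1} -> R) :
  \sum_s \sum_(w | rename s w == w) Phi (content w) =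
    \sum_(A : {ffun X -> 'I_B.+1} | (\sum_x A x == n)%N) Phi A * n`!%:R.
Proof.
rewrite (exchange_big_dep predT) //=.
rewrite (partition_big content (fun A => \sum_x A x == n)%N) /=; last first.
  by move=> w _; rewrite sum_content.
apply: eq_bigr => A /eqP/content_surj[w0 <-].
rewrite -(sum_stab_class w0) natr_sum mulr_sumr; apply: eq_bigr => w /eqP ->.
rewrite -sum1_card natr_sum mulr_sumr; apply: eq_big => s; first by rewrite inE.
by rewrite mulr1.
Qed.

End Words.
Arguments content {n} B {X} w.

Section PermChar.
Local Open Scope group_scope.
Variables (gT : finGroupType) (G : {group gT}) (T : finType).
Variables (to : {action gT &-> T}) (S : {set T}).
Hypothesis GS : [acts G, on S | to].

Definition perm_char_mx (g : gT) : 'M[algC]_#|S| :=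
  (\matrix_(i, j) (to (enum_val i) g == enum_val j)%:R)%R.

Lemma perm_char_mx_repr : mx_repr G perm_char_mx.
Proof.
split=> [|g h gG hG].
  by apply/matrixP=> i j; rewrite !mxE act1 (inj_eq enum_val_inj).
apply/matrixP=> i j; rewrite !mxE.
have tS : to (enum_val i) g \in S by rewrite (acts_act GS) // enum_valP.
rewrite (bigD1 (enum_rank_in tS (to (enum_val i) g))) //= big1 => [|k ki].
  by rewrite !mxE enum_rankK_in // eqxx mul1r GRing.addr0 actM.
rewrite !mxE; case: eqP => [e|]; last by rewrite mul0r.
by case/eqP: ki; apply: enum_val_inj; rewrite enum_rankK_in.
Qed.

Definition perm_char : 'CF(G) := cfRepr (MxRepresentation perm_char_mx_repr).

Lemma perm_char_char : perm_char \is a character.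
Proof. exact: cfRepr_char. Qed.

Lemma perm_charE g : g \in G -> (perm_char g = #|'Fix_(S | to)[g]|%:R)%R.
Proof.
move=> gG; rewrite cfunE gG mulr1n /mxtrace.
under eq_bigr do rewrite mxE.
rewrite -(big_enum_val (fun x => (to x g == x)%:R%R)) /= -natr_sum; congr _%:R%R.
rewrite -sum1_card -big_mkcondr; apply: eq_bigl => x.
by rewrite !inE sub1set !inE.
Qed.

End PermChar.

(** * Frobenius' class functions *)

(** The last moved point cannot go up, since everything above it is fixed. It gives the first
    mismatch seen from the top, both in the norm computation and in the lexicographic comparison. *)
Lemma perm_last_moved n (p : 'S_n) : p != 1%g ->
  exists i : 'I_n, (p i < i)%N /\ forall j : 'I_n, (i < j)%N -> p j = j.
Proof.
move=> p1; have [i0 pi0] : exists i, p i != i.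
  apply/existsP; apply: contraNT p1; rewrite negb_exists => /forallP h.
  by apply/eqP/permP=> i; rewrite perm1; apply/eqP; have := h i; rewrite negbK.
case: (@arg_maxnP _ i0 (fun i => p i != i) (@nat_of_ord n) pi0) => i pi imax.
have fix_gt (j : 'I_n) : (i < j)%N -> p j = j.
  by move=> ij; apply/eqP/negPn/negP => /imax; rewrite /geq /= leqNgt ij.
exists i; split=> //; rewrite ltn_neqAle pi leqNgt; apply/negP=> /fix_gt/perm_inj.
by move/eqP; rewrite (negPf pi).
Qed.

Section FrobeniusCharacter.
Variables (n B : nat) (nB : (n <= B)%N).
Local Notation V := {ffun 'I_n -> int}.
Local Notation W := {ffun 'I_n -> 'I_n}.
Local Notation C := {ffun 'I_n -> 'I_B.+1}.
Local Notation G := [set: 'S_n]%G.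

Lemma rename1 (X : finType) (w : {ffun 'I_n -> X}) : rename 1 w = w.
Proof. by apply/ffunP=> i; rewrite ffunE perm1. Qed.

(** [rename] is a left action for the product of ['S_n]; the inverse turns it into a right
    action. *)
Fact word_act_is_action :
  is_action [set: 'S_n] (fun (w : W) s => rename s^-1 w).
Proof.
apply: is_total_action => [w|w s t] /=; first by rewrite invg1 rename1.
by rewrite invMg renameM.
Qed.
Definition word_act := Action word_act_is_action.

Lemma word_acts (c : C) :
  [acts G, on [set w : W | content B w == c] | word_act].
Proof.
apply/actsP=> s _ w; rewrite !inE /=.
by rewrite content_rename.
Qed.

(** The Young permutation character of type [c]; it is zero when [c] does not sum to n. *)
Definition content_char (c : C) : 'CF(G) := perm_char (word_acts c).

Lemma content_charE c s : content_char c s =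
  #|[set w : W | (rename s w == w) && (content B w == c)]|%:R.
Proof.
rewrite perm_charE ?inE //; congr _%:R; apply: eq_card => w.
rewrite !inE sub1set inE andbC; congr (_ && _).
apply/eqP/eqP=> /= e; first by rewrite -{1}e -renameM mulgV rename1.
by rewrite -{1}e -renameM mulVg rename1.
Qed.

Lemma content_char_char c : content_char c \is a character.
Proof. exact: perm_char_char. Qed.

(** Only contents [m - permvec p] contribute, with the sign of [p]: this is the determinantal
    (Jacobi-Trudi) expansion. *)
Definition frob (m : V) : 'CF(G) :=
  \sum_(c : C) vdm_coef algC (m - vecz c) *: content_char c.

Lemma frobE m s : frob m s =
  \sum_(w : W | rename s w == w) vdm_coef algC (m - vecz (content B w)).
Proof.
rewrite sum_cfunE [RHS](partition_big (content B) predT) //=.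
apply: eq_bigr => c _; rewrite cfunE content_charE -sum1_card natr_sum mulr_sumr.
apply: eq_big => [w|w]; first by rewrite inE.
by rewrite inE mulr1 => /andP[_ /eqP ->].
Qed.

Lemma vdm_coef_int (u : V) : vdm_coef algC u \is a Num.int.
Proof.
by apply: rpred_sum => p _; rewrite rpredM ?rpred_nat // rpredX // rpredN rpred1.
Qed.

Lemma frob_vchar m : frob m \in 'Z[irr G]%g.
Proof.
apply: rpred_sum => c _; apply: scale_zchar; first exact: vdm_coef_int.
exact/char_vchar/content_char_char.
Qed.

(** A fixed word is constant on cycles, hence a choice of one letter per cycle, and each cycle adds
    its length to the multiplicity of its letter. So the value is a [hook_walk] over cycle
    lengths. *)
Lemma norm_frob m s : `|frob m s| <= (#|porbits s|)`!%:R.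
Proof.
(* Increasing length puts the longest cycle last, where [norm_hook_walk] removes it first. *)
pose l := sort (relpre (fun A : {set 'I_n} => #|A|) leq) (enum (porbits s)).
have ml A : (A \in l) = (A \in porbits s) by rewrite mem_sort mem_enum.
have ul : uniq l by rewrite sort_uniq enum_uniq.
have sl : size l = #|porbits s| by rewrite size_sort cardE.
set k := #|porbits s| in sl *.
have idx_lt (x : 'I_n) : (index (porbit s x) l < k)%N.
  by rewrite -sl index_mem ml imset_f.
pose idx x := Ordinal (idx_lt x).
pose sz i := #|nth set0 l i|.
have szE (o : 'I_k) : [set x | idx x == o] = nth set0 l o.
  have : nth set0 l o \in porbits s by rewrite -ml mem_nth // sl.
  case/imsetP=> y _ ey; apply/setP=> x; rewrite inE ey -eq_porbit_mem -ey.
  rewrite -val_eqE /=; apply/eqP/eqP=> [<-|->]; first by rewrite nth_index // ml imset_f.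
  by rewrite index_uniq // sl.
have sz_gt0 i : (i < k)%N -> (0 < sz i)%N.
  move=> ik; have : nth set0 l i \in porbits s by rewrite -ml mem_nth // sl.
  case/imsetP=> x _; rewrite /sz => ->; apply/card_gt0P; exists x.
  exact: porbit_id.
suff -> : frob m s = hook_walk algC sz k m.
  apply: norm_hook_walk => [i j ij jk|]; last exact: sz_gt0.
  have lt : sorted (relpre (fun A : {set 'I_n} => #|A|) leq) l.
    by apply: sort_sorted => A A'; exact: leq_total.
  apply: (sorted_leq_nth _ _ set0 lt) => //; last by rewrite inE sl.
  - by move=> A A' A''; exact: leq_trans.
  - by move=> A /=.
  - by rewrite inE sl; exact: leq_ltn_trans jk.
rewrite frobE /hook_walk -sum_walk.
pose colour (phi : {ffun 'I_k -> 'I_n}) : W := [ffun x => phi (idx x)].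
have idx_surj (o : 'I_k) : exists x, idx x == o.
  by have /card_gt0P[x] := sz_gt0 o (ltn_ord o); rewrite /sz -szE inE; exists x.
pose pt o := xchoose (idx_surj o).
have ptK o : idx (pt o) = o by apply/eqP; exact: (xchooseP (idx_surj o)).
pose uncolour (w : W) : {ffun 'I_k -> 'I_n} := [ffun o => w (pt o)].
have colourK w : rename s w == w -> colour (uncolour w) = w.
  move=> /eqP ws; apply/ffunP=> x; rewrite !ffunE.
  have : pt (idx x) \in porbit s x.
    have := szE (idx x); rewrite nth_index ?ml ?imset_f // => <-.
    by rewrite inE ptK.
  case/porbitP=> j ->; elim: j => [|j IH]; first by rewrite expg0 perm1.
  by rewrite -IH -[in RHS]ws ffunE expgSr permM.
rewrite (reindex_onto colour uncolour colourK); apply: eq_big => [phi|phi _].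
  transitivity true; last by symmetry; apply/forallP.
  apply/andP; split; apply/eqP/ffunP=> x; rewrite !ffunE ?ptK //.
  congr (phi _); apply: val_inj => /=; congr index; apply/eqP.
  rewrite eq_porbit_mem.
  by have := mem_porbit s 1 x; rewrite expg1.
congr (vdm_coef _ (_ - _)); apply/ffunP=> j; rewrite ffunE contentE // sum_ffunE.
rewrite -sum1_card (partition_big idx predT) //= (big_morph Posz PoszD (erefl _)).
apply: eq_bigr => o _; rewrite ffunE.
rewrite (eq_bigl (fun x => (j == phi o) && (idx x == o))); last first.
  move=> x; rewrite inE ffunE; case: (idx x =P o) => [->|_]; last by rewrite !andbF.
  by rewrite eq_sym.
case: eqP => _; last by rewrite big_pred0.
by rewrite /sz -szE -sum1_card; congr Posz; apply: eq_bigl => x; rewrite inE.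
Qed.

Lemma content_fst (z : {ffun 'I_n -> 'I_n * 'I_n}) (i : 'I_n) :
  (content B [ffun x => (z x).1] i = \sum_j content B z (i, j) :> nat)%N.
Proof.
rewrite contentE // -sum1_card (partition_big (fun x => (z x).2) predT) //=.
apply: eq_bigr => j _; rewrite contentE // -sum1_card; apply: eq_bigl => x.
by rewrite !inE ffunE -pair_eqE.
Qed.

Lemma content_snd (z : {ffun 'I_n -> 'I_n * 'I_n}) (j : 'I_n) :
  (content B [ffun x => (z x).2] j = \sum_i content B z (i, j) :> nat)%N.
Proof.
rewrite contentE // -sum1_card (partition_big (fun x => (z x).1) predT) //=.
apply: eq_bigr => i _; rewrite contentE // -sum1_card; apply: eq_bigl => x.
by rewrite !inE ffunE -pair_eqE andbC.
Qed.

Definition row_sums (A : {ffun 'I_n * 'I_n -> 'I_B.+1}) : V :=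
  [ffun i => \sum_j (A (i, j) : nat)%:Z].
Definition col_sums (A : {ffun 'I_n * 'I_n -> 'I_B.+1}) : V :=
  [ffun j => \sum_i (A (i, j) : nat)%:Z].

Lemma conj_vdm_coef (u : V) : (vdm_coef algC u)^* = vdm_coef algC u.
Proof. exact/CrealP/Rreal_int/vdm_coef_int. Qed.

(** A pair of words fixed by s is one fixed word over pairs of letters, whose content is a matrix
    with the two contents as row and column sums; [sum_fixed_words] then averages over s. *)
Lemma frob_cfnorm m : '[frob m] =
  \sum_(A : {ffun 'I_n * 'I_n -> 'I_B.+1} | (\sum_x A x == n)%N)
     vdm_coef algC (m - row_sums A) * vdm_coef algC (m - col_sums A).
Proof.
have n0 : n`!%:R != 0 :> algC by rewrite pnatr_eq0 -lt0n fact_gt0.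
apply: (mulIf n0); rewrite mulr_suml -(sum_fixed_words nB) cfdotE cardsT card_Sn.
rewrite mulrAC mulVf // mul1r; apply: eq_big => [s|s _]; first by rewrite inE.
rewrite frobE rmorph_sum mulr_suml.
under eq_bigr => w _.
  rewrite mulr_sumr; under eq_bigr => w' _ do rewrite /= conj_vdm_coef.
  over.
rewrite pair_big /=.
pose unz (z : {ffun 'I_n -> 'I_n * 'I_n}) : W * W :=
  ([ffun x => (z x).1], [ffun x => (z x).2]).
rewrite (reindex unz) /=; last first.
  exists (fun ww : W * W => [ffun x => (ww.1 x, ww.2 x)]) => [z|[w w']] _.
    by apply/ffunP=> x; rewrite !ffunE -surjective_pairing.
  by congr (_, _); apply/ffunP=> x; rewrite !ffunE.
apply: eq_big => [z|z _].
  apply/andP/eqP=> [[/eqP/ffunP e1 /eqP/ffunP e2]|e].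
    apply/ffunP=> x; have := e1 x; have := e2 x; rewrite !ffunE.
    by case: (z x) (z (s x)) => [a b] [c d] /= -> ->.
  by rewrite -{2 4}e; split; apply/eqP/ffunP=> x; rewrite !ffunE.
congr (_ * _); congr vdm_coef; congr (_ - _); apply/ffunP=> i.
  rewrite [LHS]ffunE [RHS]ffunE content_fst.
  by rewrite (big_morph Posz PoszD (erefl _)).
rewrite [LHS]ffunE [RHS]ffunE content_snd.
by rewrite (big_morph Posz PoszD (erefl _)).
Qed.

(** A matrix is the family of its rows. The default 0 of [oapp] is never reached, as the walk has n
    rows. *)
Lemma sum_row_walk (m u : V) :
  \sum_(A : {ffun 'I_n * 'I_n -> 'I_B.+1} | row_sums A == u)
     vdm_coef algC (m - col_sums A) =
  row_walk algC B (fun i => oapp u 0 (insub i)) n m.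
Proof.
rewrite /row_walk -sum_walk.
pose tab (phi : {ffun 'I_n -> C}) : {ffun 'I_n * 'I_n -> 'I_B.+1} :=
  [ffun x => phi x.1 x.2].
rewrite (reindex tab) /=; last first.
  exists (fun A => [ffun i => [ffun j => A (i, j)]]) => [phi|A] _.
    by apply/ffunP=> i; apply/ffunP=> j; rewrite !ffunE.
  by apply/ffunP=> -[i j]; rewrite !ffunE.
apply: eq_big => [phi|phi _].
  apply/eqP/forallP=> [<- i|e].
    rewrite valK /= ffunE; apply/eqP/eq_bigr => j _; by rewrite !ffunE.
  apply/ffunP=> i; have /eqP := e i; rewrite valK /= ffunE => <-.
  by apply: eq_bigr => j _; rewrite !ffunE.
congr (vdm_coef _ (_ - _)); apply/ffunP=> j; rewrite ffunE sum_ffunE.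
by apply: eq_bigr => i _; rewrite !ffunE.
Qed.

(** Expanding the row factor over [p] prescribes the row sums [lam i + i - p i]. For [p = 1] they
    match [lam] and give 1; otherwise the last moved point has a row sum above [lam i], later rows
    match, and the term vanishes. *)
Lemma frob_cfnorm1 (lam : nat -> nat) :
    (forall i j, (i <= j < n)%N -> (lam i <= lam j)%N) ->
    (forall i, (i < n)%N -> (i + lam i <= B)%N) ->
    (\sum_(i < n) lam i)%N = n ->
  '[frob (beta n lam 0)] = 1.
Proof.
move=> lmono lB lsum; set m := beta n lam 0.
have mE (i : 'I_n) : m i = (i + lam i)%:Z by rewrite ffunE ltn0 subn0.
have rE p i (iN : (i < n)%N) : oapp (m - permvec p) 0 (insub i) =
    (i + lam i)%:Z - (p (Ordinal iN) : nat)%:Z.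
  by rewrite (insubT (fun i => i < n)%N iN) /= /m /beta !ffunE /= subn0.
rewrite frob_cfnorm.
rewrite (eq_bigl (fun A : {ffun 'I_n * 'I_n -> 'I_B.+1} =>
  predT A && (\sum_x A x == n)%N)) // big_mkcondr /=.
transitivity (\sum_(p : 'S_n) (-1) ^+ p *
    row_walk algC B (fun i => oapp (m - permvec p) 0 (insub i)) n m); last first.
  have mn : m = beta n lam (n - n) by rewrite subnn.
  rewrite (bigD1 1%g) //= odd_perm1 mul1r [X in row_walk _ _ _ _ X + _]mn.
  rewrite row_walk_eq1 // => [|i iN]; last first.
    by rewrite rE perm1 /= PoszD addrAC subrr add0r.
  rewrite big1 ?addr0 // => p /perm_last_moved[i [pi fix_gt]].
  rewrite [X in row_walk _ _ _ _ X]mn.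
  rewrite (@row_walk_eq0 _ _ _ _ _ lmono lB n i) ?mulr0 ?ltn_ord //=.
  - by rewrite (rE p i (ltn_ord i)) (_ : Ordinal _ = i); [lia | exact: val_inj].
  - by move=> j /andP[_ jn]; rewrite (rE p j jn); have := lB j jn; lia.
  - move=> j /andP[ij jn]; rewrite (rE p j jn) fix_gt //=.
    by rewrite PoszD addrAC subrr add0r.
(* The restriction to total n is automatic: a nonzero row factor forces
   [row_sums A = m - permvec p], of total n. *)
transitivity (\sum_(A : {ffun 'I_n * 'I_n -> 'I_B.+1})
    vdm_coef algC (m - row_sums A) * vdm_coef algC (m - col_sums A)).
  apply: eq_bigr => A _; case: ifP => // An.
  have [->|/vdm_neq0[p /ffunP mp]] := eqVneq (vdm_coef algC (m - row_sums A)) 0.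
    by rewrite mul0r.
  case/eqP: An; apply/eqP; rewrite -eqz_nat (big_morph Posz PoszD (erefl _)).
  have <- : \sum_i row_sums A i = n%:Z.
    have sp : \sum_i permvec p i = \sum_(i < n) (i : nat)%:Z.
      rewrite [RHS](reindex_inj (@perm_inj _ p)).
      by apply: eq_bigr => i _; rewrite ffunE.
    have : \sum_i (m - row_sums A) i = \sum_i permvec p i by apply: eq_bigr.
    under eq_bigr => i _ do rewrite !ffunE.
    rewrite sumrB sp (eq_bigr (fun i : 'I_n => (i : nat)%:Z + (lam i)%:Z)) => [|i _].
      rewrite big_split /= -addrA -[RHS]addr0 => /addrI/eqP.
      rewrite subr_eq0 eq_sym -(big_morph Posz PoszD (erefl _)) lsum => /eqP <-.
      by apply: eq_bigr => i _; rewrite ffunE.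
    by rewrite -PoszD -mE ffunE.
  apply/eqP; under [RHS]eq_bigr do rewrite ffunE.
  by rewrite pair_big; apply: eq_big => -[].
rewrite {1}/vdm_coef; under eq_bigr => A _ do rewrite mulr_suml.
rewrite exchange_big; apply: eq_bigr => p _ /=.
rewrite -sum_row_walk mulr_sumr [RHS]big_mkcond; apply: eq_bigr => A _ /=.
have -> : (row_sums A == m - permvec p) = (m - row_sums A == permvec p).
  by rewrite -subr_eq0 -[RHS]subr_eq0 -oppr_eq0 opprB addrAC.
by case: eqP => _; rewrite ?mulr1 ?mulr0 ?mul0r.
Qed.

End FrobeniusCharacter.

(** * Irreducible characters *)

Section LexKey.
Variables n B : nat.
Local Notation C := {ffun 'I_n -> 'I_B.+1}.

(** Contents are read in base [B.+1] with the last entry most significant, so that lexicographic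
    order becomes the order of numbers. *)
Definition lex_key (c : C) : nat := (\sum_i c i * B.+1 ^ i)%N.

Lemma lex_key_low (c : C) k : (k <= n)%N ->
  (\sum_(i : 'I_n | (i < k)%N) c i * B.+1 ^ i < B.+1 ^ k)%N.
Proof.
elim: k => [|k IH] kn; first by rewrite big_pred0.
rewrite (bigD1 (Ordinal kn)) //= expnS.
rewrite (eq_bigl (fun i : 'I_n => (i < k)%N)); last first.
  by move=> i; rewrite ltnS ltn_neqAle andbC.
apply: (@leq_trans ((c (Ordinal kn)).+1 * B.+1 ^ k)%N).
  by rewrite mulSn addnC ltn_add2r IH // ltnW.
by rewrite leq_mul2r ltn_ord orbT.
Qed.

Lemma lex_key_lt (c c' : C) (i : 'I_n) :
    (c i < c' i)%N -> (forall j : 'I_n, (i < j)%N -> c j = c' j) ->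
  (lex_key c < lex_key c')%N.
Proof.
move=> lt eq_gt; rewrite /lex_key.
rewrite (bigID (fun j : 'I_n => i < j)%N).
rewrite [ltnRHS](bigID (fun j : 'I_n => i < j)%N) /=.
under eq_bigr => j ij do rewrite eq_gt //.
rewrite ltn_add2l (bigD1 i) ?ltnn //= [ltnRHS](bigD1 i) ?ltnn //=.
rewrite (eq_bigl (fun j : 'I_n => (j < i)%N)); last first.
  by move=> j; rewrite -leqNgt ltn_neqAle andbC.
apply: (@leq_trans ((c i).+1 * B.+1 ^ i)%N).
  by rewrite mulSn addnC ltn_add2r lex_key_low // ltnW.
by apply: leq_trans (leq_addr _ _); rewrite leq_mul2r lt orbT.
Qed.

End LexKey.

Section Irreducibles.
Variables (n B : nat) (nB : (n <= B)%N).
Local Notation V := {ffun 'I_n -> int}.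
Local Notation W := {ffun 'I_n -> 'I_n}.
Local Notation C := {ffun 'I_n -> 'I_B.+1}.
Local Notation G := [set: 'S_n]%G.

(** Relabelling letters commutes with permuting positions. *)
Lemma content_char_perm (c : C) (p : 'S_n) :
  content_char nB [ffun i => c (p i)] = content_char nB c.
Proof.
apply/cfunP=> s; rewrite !content_charE; congr _%:R.
pose relabel (w : W) : W := [ffun x => (p^-1)%g (w x)].
have relI : injective relabel.
  move=> w w' /ffunP e; apply/ffunP=> x; have := e x; rewrite !ffunE.
  exact: perm_inj.
have relE w i : content B (relabel w) i = content B w (p i).
  apply: val_inj; rewrite /= !contentE //; apply: eq_card => x.
  by rewrite !inE ffunE -(inj_eq (@perm_inj _ p)) permKV.
have relR w : rename s (relabel w) = relabel (rename s w).
  by apply/ffunP=> x; rewrite !ffunE.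
rewrite -[RHS](card_imset _ relI); apply: eq_card => w; apply/idP/imsetP.
  rewrite inE => /andP[/eqP ws /eqP wc].
  pose w' : W := [ffun x => p (w x)].
  have e : relabel w' = w by apply/ffunP=> x; rewrite !ffunE permK.
  exists w' => //; rewrite inE; apply/andP; split.
    by rewrite -(inj_eq relI) -relR e ws.
  apply/eqP/ffunP=> i; have := relE w' ((p^-1)%g i).
  by rewrite e wc ffunE permKV.
case=> w'; rewrite inE => /andP[/eqP ws /eqP wc] ->; rewrite inE relR ws eqxx.
by apply/eqP/ffunP=> i; rewrite relE wc [RHS]ffunE.
Qed.

(** The identity word has all multiplicities 1. Words of this content have distinct letters and are
    fixed only by the identity, so the pairing reduces to a nonzero multiple of the conjugate of
    [chi 1]. *)
Lemma content_char_id_irr (chi : 'CF(G)) : chi \in irr G ->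
  '[content_char nB (content B [ffun x : 'I_n => x]), chi] != 0.
Proof.
case/irrP=> i ->; rewrite cfdotE (bigD1 1%g) ?inE //=.
rewrite big1 ?addr0 => [|s /andP[_ s1]].
  rewrite mulf_neq0 ?invr_eq0 ?neq0CG // mulf_neq0 ?conjC_eq0 ?irr1_neq0 //.
  rewrite content_charE // pnatr_eq0 -lt0n; apply/card_gt0P.
  by exists [ffun x => x]; rewrite inE rename1 !eqxx.
rewrite content_charE // [X in X%:R](_ : _ = 0%N) ?mul0r //.
apply/eqP; rewrite cards_eq0; apply/eqP/setP=> w; rewrite !inE; apply/negP.
case/andP=> /eqP ws /eqP wc; case/eqP: s1; apply/permP=> x; rewrite perm1.
have : #|[set y | w y == w x]| = 1%N.
  rewrite -(contentE nB) wc contentE //.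
  rewrite (_ : [set _ | _] = [set w x]) ?cards1 //.
  by apply/setP=> y; rewrite !inE ffunE.
move/eqP/cards1P=> [z /setP e].
have wsx : w (s x) = w x by rewrite -{2}ws ffunE.
have := e x; have := e (s x); rewrite !inE wsx eqxx.
by move=> /esym/eqP -> /esym/eqP ->.
Qed.

(* The content c maximizing [lex_key] among those whose word character meets chi
   is the partition indexing chi. *)
Lemma exists_frob_irr (chi : 'CF(G)) : (n + n <= B)%N -> chi \in irr G ->
  exists lam : nat -> nat,
  [/\ forall i j, (i <= j < n)%N -> (lam i <= lam j)%N,
      forall i, (i < n)%N -> (i + lam i <= B)%N,
      (\sum_(i < n) lam i)%N = n &
      '[frob nB (beta n lam 0), chi] != 0].
Proof.
move=> nnB irrchi; have := content_char_id_irr irrchi; set c0 := content _ _ => c0P.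
case: (@arg_maxnP _ c0 (fun c => '[content_char nB c, chi] != 0)
  (@lex_key n B) c0P) => c cP cmax.
have cmax0 c' : (lex_key c < lex_key c')%N -> '[content_char nB c', chi] = 0.
  move=> lt; apply/eqP; apply: contraTT lt => /cmax; rewrite /geq /= -leqNgt; exact.
have csum : (\sum_i c i)%N = n.
  have [w /eqP <-|nw] := pickP (fun w : W => content B w == c).
    exact: sum_content.
  case/eqP: cP; suff -> : content_char nB c = 0 by rewrite cfdot0l.
  apply/cfunP=> s; rewrite content_charE // cfunE [X in X%:R](_ : _ = 0%N) //.
  by apply/eqP; rewrite cards_eq0; apply/eqP/setP=> w; rewrite !inE nw andbF.
(* A descent could be swapped away, giving a lexicographically larger content with the same
   character. *)
have cmono (i j : 'I_n) : (i < j)%N -> (c i <= c j)%N.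
  move=> ij; rewrite leqNgt; apply/negP=> lt.
  have := cmax0 [ffun x => c (tperm i j x)]; rewrite content_char_perm => h.
  case/eqP: cP; apply: h; apply: (lex_key_lt (i := j)); first by rewrite ffunE tpermR.
  move=> x jx; rewrite ffunE tpermD //; apply/eqP=> e; move: ij jx; rewrite e; lia.
pose lam i : nat := oapp (fun x => c x : nat) 0%N (insub i).
have lamE (i : 'I_n) : lam i = c i by rewrite /lam valK.
exists lam; split.
- move=> i j /andP[ij jn]; have iN := leq_ltn_trans ij jn.
  rewrite (lamE (Ordinal iN)) (lamE (Ordinal jn)).
  move: ij; rewrite leq_eqVlt => /orP[/eqP e|]; last first.
    exact: (cmono (Ordinal iN) (Ordinal jn)).
  by rewrite (_ : Ordinal iN = Ordinal jn) //; apply: val_inj.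
- move=> i iN; rewrite (lamE (Ordinal iN)); apply: leq_trans nnB.
  apply: leq_add (ltnW iN) _; apply: leq_trans (_ : (\sum_i c i <= n)%N).
    by rewrite (bigD1 (Ordinal iN)) //= leq_addr.
  by rewrite csum.
- by rewrite -[RHS]csum; apply: eq_bigr => i _; rewrite lamE.
have mE (i : 'I_n) : beta n lam 0 i = (i + c i)%:Z.
  by rewrite ffunE ltn0 subn0 lamE.
rewrite /frob cfdot_suml (bigD1 c) //= cfdotZl.
have -> : beta n lam 0 - vecz c = permvec 1.
  by apply/ffunP=> i; rewrite [LHS]ffunE mE !ffunE perm1 PoszD addrK.
rewrite vdm_permvec odd_perm1 mul1r big1 ?addr0 // => c' c'c; rewrite cfdotZl.
(* Any other contributing [c'] has [c' i = c i + i - p i]. At the last point moved by [p] it exceeds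
   [c], and beyond it agrees, so it is lexicographically larger and does not meet [chi]. *)
have [->|/vdm_neq0[p /ffunP pE]] :=
    eqVneq (vdm_coef algC (beta n lam 0 - vecz c')) 0.
  by rewrite mul0r.
have c'E i : (c' i + p i = i + c i)%N.
  by have := pE i; rewrite [X in X = _]ffunE mE !ffunE; lia.
have [p1|/perm_last_moved[i [pi fix_gt]]] := eqVneq p 1%g.
  case/eqP: c'c; apply/ffunP=> i; apply: val_inj => /=.
  by have := c'E i; rewrite p1 perm1 addnC => /addnI.
rewrite cmax0 ?mulr0 //; apply: (lex_key_lt (i := i)) => [|j ij].
  by rewrite -(ltn_add2r (p i)) c'E addnC ltn_add2r.
by apply: val_inj => /=; have := c'E j; rewrite fix_gt // addnC => /addnI.
Qed.
End Irreducibles.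

Theorem theorem7p2 (n : nat) (hn : (0 < n)%N) (k : nat) (sigma : 'S_n)
    (hk : #|porbits sigma| = k) (chi : 'CF([set: 'S_n]%G))
    (hchi : chi \in irr [set: 'S_n]%G) :
  `|chi sigma| <= (2 ^ (k - 1) * k`!)%:R.
Proof.
have nB : (n <= n + n)%N := leq_addr n n.
have [lam [lmono lB lsum nz]] := exists_frob_irr nB (leqnn _) hchi.
(* A virtual character of norm 1 is an irreducible up to sign; its nonzero pairing with [chi]
   identifies which one. *)
have [b [j fE]] := vchar_norm1P (frob_vchar nB _) (frob_cfnorm1 nB lmono lB lsum).
have chiE : chi = 'chi_j.
  move: nz; rewrite fE; case/irrP: hchi => i ->; rewrite cfdotZl cfdot_irr.
  by have [->|_] := eqVneq j i; rewrite ?mulr0 ?eqxx.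
have -> : `|chi sigma| = `|frob nB (beta n lam 0) sigma|.
  by rewrite fE cfunE normrM normr_sign mul1r chiE.
apply: le_trans (norm_frob nB _ _) _.
by rewrite hk ler_nat leq_pmull // expn_gt0.
Qed.
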